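(* Let $b,c$ be real numbers with $c\geq 9$ and $b/c>2$, and let $\varepsilon>0$. With $r_n,s_n,h_n,\Xi$ and the class of admissible functions as defined in the context, there exist a Lipschitz admissible function $\mathcal{N}:\mathbb{R}^2\to\mathbb{R}$ and an integer $\overline{n}\geq 1$ such that there is a sequence $\{\tilde{\sigma}_n\}_{n\geq 0}\subset\mathbb{R}^2$ with $\tilde{\sigma}_0$ a minimizer over $x\in\mathbb{R}^2$ of $$|1-\mathcal{N}(x)|+2\|x\|,$$ $\tilde{\sigma}_{n+1}$, for any $n\geq 0$, a minimizer over $x\in\mathbb{R}^2$ of $$b^{n+1}|1-\mathcal{N}(x)|+(b/c)^{n+1}\|x\|+\|x-\tilde{\sigma}_n\|,$$ and such that for any $n\geq 0$ $$\tilde{\sigma}_n=r_n(\cos(\theta_n),\sin(\theta_n)),$$ where $\theta_n\in[0,+\infty)$ satisfies $\theta_n=0$ for any $0\leq n\leq 2\overline{n}$ and, for any $m\geq 1$, $\theta_n=m\pi/2$ for $n=2\overline{n}+2m-1$ and $n=2\overline{n}+2m$.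
   Context: $\|\cdot\|$ is the Euclidean norm on $\mathbb{R}^2$. (The recursion is the multiscale scheme in which, with $X=E=\mathbb{R}^2$, $Y=\mathbb{R}$, $\hat{\mathcal{N}}=1$, $\alpha=\beta=\gamma=1$, $\lambda_n=b^n$, $a_n=c^{-n}$, one minimizes $\lambda_n[|\hat{\mathcal{N}}-\mathcal{N}(x)|^{\alpha}+a_n\|x\|^{\gamma}]+\|x-\tilde{\sigma}_{n-1}\|^{\beta}$, with $\tilde{\sigma}_{-1}=0$.) For $n\geq 0$: $$r_n=\sum_{j=0}^{n}\left(\tfrac12\right)^{j+1},\qquad s_n=r_n+\frac{r_{n+1}-r_n}{2},\qquad h_n=1-\frac98\left(\frac{1}{c^{n+1}}+\frac{1}{b^{n+1}}\right)\frac{1}{2^{n+2}}.$$ The function $\Xi:\mathbb{R}^2\to\mathbb{R}$ is radial, $\Xi(x)=\tilde{\Xi}(\|x\|)$, with $$\tilde{\Xi}(r)=\begin{cases}h_0+2(r-r_0)-\varepsilon(r-r_0)^2&\text{if }0\leq r\leq r_0\\ h_n&\text{if }r_n\leq r\leq s_n,\ n\geq 0\\ h_n+\frac{h_{n+1}-h_n}{r_{n+1}-s_n}(r-s_n)&\text{if }s_n\leq r\leq r_{n+1},\ n\geq 0\\ 1+2(r-1)&\text{if }1\leq r.\end{cases}$$ A continuous function $\mathcal{N}:\mathbb{R}^2\to\mathbb{R}$ is called admissible here if: for every $x$, $\mathcal{N}(x)$ is greater than, equal to, or less than $1$ if and only if $\|x\|$ is, respectively; $\mathcal{N}(x)\leq\Xi(x)$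 for every $x$; $\mathcal{N}(x)=\Xi(x)$ whenever $\|x\|\leq r_0$, or $r_{2n}\leq\|x\|\leq s_{2n}$ for some $n\geq 0$, or $s_{2n+1}\leq\|x\|\leq r_{2n+2}$ for some $n\geq 0$, or $\|x\|\geq 1$; and $h_{2n}\leq\mathcal{N}(x)\leq\Xi(x)$ whenever $s_{2n}\leq\|x\|\leq s_{2n+1}$, $n\geq 0$. *)

(* Defs.v *)
From Stdlib Require Import Reals Lra Lia ClassicalEpsilon.
From Coquelicot Require Import Coquelicot.
Open Scope R_scope.

(* The points of R^2 are pairs.  Coquelicot's [norm] on the product space
   R * R is the Euclidean norm, not the maximum norm: see [norm_euclidean]. *)
Lemma norm_euclidean (x : R * R) : norm x = sqrt (fst x ^ 2 + snd x ^ 2).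
Proof.
  change (sqrt (Rabs (fst x) ^ 2 + Rabs (snd x) ^ 2) = sqrt (fst x ^ 2 + snd x ^ 2)).
  now rewrite !pow2_abs.
Qed.

Definition is_minimizer (f : R * R -> R) (x : R * R) : Prop :=
  forall y : R * R, f x <= f y.

Definition lipschitz (f : R * R -> R) : Prop :=
  exists L : R, forall x y : R * R, Rabs (f x - f y) <= L * norm (minus x y).

Definition r_ (n : nat) : R := sum_f_R0 (fun j => (1 / 2) ^ (j + 1)) n.

Definition s_ (n : nat) : R := r_ n + (r_ (n + 1) - r_ n) / 2.

Definition h_ (b c : R) (n : nat) : R :=
  1 - 9 / 8 * (1 / c ^ (n + 1) + 1 / b ^ (n + 1)) * (1 / 2 ^ (n + 2)).

(* The clauses overlap at their end points, where they agree: on r >= 0 this is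
   the graph of a function (see [Xi_graph_exists] and [Xi_graph_unique]). *)
Definition Xi_graph (b c eps r y : R) : Prop :=
  (0 <= r <= r_ 0 /\ y = h_ b c 0 + 2 * (r - r_ 0) - eps * (r - r_ 0) ^ 2) \/
  (exists n : nat, r_ n <= r <= s_ n /\ y = h_ b c n) \/
  (exists n : nat, s_ n <= r <= r_ (n + 1) /\
     y = h_ b c n +
         (h_ b c (n + 1) - h_ b c n) / (r_ (n + 1) - s_ n) * (r - s_ n)) \/
  (1 <= r /\ y = 1 + 2 * (r - 1)).

Definition Xi_tilde (b c eps r : R) : R :=
  epsilon (inhabits 0) (Xi_graph b c eps r).

Definition Xi (b c eps : R) (x : R * R) : R := Xi_tilde b c eps (norm x).

Record admissible (b c eps : R) (N : R * R -> R) : Prop := {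
  adm_continuous : forall x, continuous N x;
  adm_gt1 : forall x, N x > 1 <-> norm x > 1;
  adm_eq1 : forall x, N x = 1 <-> norm x = 1;
  adm_lt1 : forall x, N x < 1 <-> norm x < 1;
  adm_le_Xi : forall x, N x <= Xi b c eps x;
  adm_inner : forall x, norm x <= r_ 0 -> N x = Xi b c eps x;
  adm_even : forall (n : nat) x,
    r_ (2 * n) <= norm x <= s_ (2 * n) -> N x = Xi b c eps x;
  adm_odd : forall (n : nat) x,
    s_ (2 * n + 1) <= norm x <= r_ (2 * n + 2) -> N x = Xi b c eps x;
  adm_outer : forall x, norm x >= 1 -> N x = Xi b c eps x;
  adm_between : forall (n : nat) x,
    s_ (2 * n) <= norm x <= s_ (2 * n + 1) ->
    h_ b c (2 * n) <= N x <= Xi b c eps x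
}.

Lemma r_E (n : nat) : r_ n = 1 - (1 / 2) ^ (n + 1).
Proof.
  unfold r_; induction n as [|n IH]; [simpl; lra|].
  rewrite tech5, IH, !pow_add; simpl; lra.
Qed.

Lemma r_lt1 (n : nat) : r_ n < 1.
Proof. rewrite r_E; assert (0 < (1 / 2) ^ (n + 1)) by (apply pow_lt; lra); lra. Qed.

Lemma r_lt_s (n : nat) : r_ n < s_ n.
Proof.
  unfold s_; rewrite !r_E, (pow_add _ (n + 1) 1).
  assert (0 < (1 / 2) ^ (n + 1)) by (apply pow_lt; lra); simpl; lra.
Qed.

Lemma s_lt_r (n : nat) : s_ n < r_ (n + 1).
Proof. generalize (r_lt_s n); unfold s_; lra. Qed.

Lemma r_le (m n : nat) : (m <= n)%nat -> r_ m <= r_ n.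
Proof.
  induction 1 as [|n _ IH]; [lra|].
  generalize (r_lt_s n) (s_lt_r n); rewrite Nat.add_1_r; lra.
Qed.

Lemma Xi_graph_exists (b c eps r : R) :
  0 <= r -> exists y, Xi_graph b c eps r y.
Proof.
  intros r0; unfold Xi_graph.
  destruct (Rle_dec 1 r) as [r1|r1]; [eexists; right; right; right; eauto|].
  assert (Hn : exists n, r < r_ n).
  { destruct (pow_lt_1_zero (1 / 2)) with (y := 1 - r) as [n Hn].
    - rewrite Rabs_pos_eq; lra.
    - lra.
    - exists n; rewrite r_E.
      specialize (Hn (n + 1)%nat ltac:(lia)).
      rewrite Rabs_pos_eq in Hn; [lra|apply pow_le; lra]. }
  destruct Hn as [n Hn]; induction n as [|n IH].
  - eexists; left; split; [lra|reflexivity].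
  - destruct (Rlt_dec r (r_ n)) as [H|H]; [auto|].
    rewrite <- Nat.add_1_r in Hn.
    destruct (Rle_dec r (s_ n)) as [H'|H'].
    + eexists; right; left; exists n; split; [lra|reflexivity].
    + eexists; right; right; left; exists n; split; [lra|reflexivity].
Qed.

Lemma r_sep (m n : nat) : (m < n)%nat -> r_ n <= r_ (m + 1) -> n = (m + 1)%nat.
Proof.
  intros mn le; destruct (Nat.eq_dec n (m + 1)) as [|ne]; [assumption|].
  generalize (r_le (m + 1 + 1) n ltac:(lia)) (r_lt_s (m + 1)) (s_lt_r (m + 1)); lra.
Qed.

Lemma Xi_graph_unique (b c eps r y z : R) :
  Xi_graph b c eps r y -> Xi_graph b c eps r z -> y = z.
Proof.
  pose (band n := if Rle_dec r (s_ n) then h_ b c n else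
    h_ b c n + (h_ b c (n + 1) - h_ b c n) / (r_ (n + 1) - s_ n) * (r - s_ n)).
  assert (left_end : forall n, r = r_ n -> band n = h_ b c n).
  { intros n e; unfold band; destruct (Rle_dec r (s_ n)); [reflexivity|].
    generalize (r_lt_s n); lra. }
  assert (right_end : forall n, r = r_ (n + 1) -> band n = h_ b c (n + 1)).
  { intros n e; unfold band; generalize (s_lt_r n); intros lt.
    destruct (Rle_dec r (s_ n)); [lra|].
    rewrite e; field; lra. }
  assert (step : forall m n, (m < n)%nat -> r <= r_ (m + 1) -> r_ n <= r ->
    band m = band n).
  { intros m n mn rm rn.
    assert (e := r_sep m n mn ltac:(lra)); subst n.
    rewrite right_end, left_end by lra; reflexivity. }
  assert (inner : forall n, r <= r_ 0 -> r_ n <= r ->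
    band n = h_ b c 0 + 2 * (r - r_ 0) - eps * (r - r_ 0) ^ 2).
  { intros n le0 len.
    destruct n as [|n].
    - rewrite left_end by lra; replace r with (r_ 0) by lra; ring.
    - generalize (r_le 1 (S n) ltac:(lia)) (r_lt_s 0) (s_lt_r 0); simpl (0 + 1)%nat; lra. }
  assert (split : forall w, Xi_graph b c eps r w ->
    (r <= r_ 0 /\ w = h_ b c 0 + 2 * (r - r_ 0) - eps * (r - r_ 0) ^ 2) \/
    (exists n, r_ n <= r <= r_ (n + 1) /\ w = band n) \/
    (1 <= r /\ w = 1 + 2 * (r - 1))).
  { intros w [[H ->]|[[n [H ->]]|[[n [H ->]]|H]]].
    - left; split; [lra|reflexivity].
    - right; left; exists n; split; [generalize (s_lt_r n); lra|].
      unfold band; destruct (Rle_dec r (s_ n)); [reflexivity|lra].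
    - right; left; exists n; split; [generalize (r_lt_s n); lra|].
      unfold band; destruct (Rle_dec r (s_ n)); [|reflexivity].
      replace (r - s_ n) with 0 by lra; ring.
    - auto. }
  intros Hy Hz.
  destruct (split y Hy) as [[H ->]|[[n [H ->]]|[H ->]]];
    destruct (split z Hz) as [[K ->]|[[m [K ->]]|[K ->]]];
    try reflexivity;
    try (generalize (r_lt1 0); lra);
    try (generalize (r_lt1 (n + 1)); lra);
    try (generalize (r_lt1 (m + 1)); lra).
  - symmetry; apply inner; lra.
  - apply inner; lra.
  - destruct (Nat.lt_trichotomy n m) as [lt|[->|lt]]; [|reflexivity|symmetry];
      apply step; trivial; lra.
Qed.

Lemma Xi_tildeP (b c eps r y : R) :
  0 <= r -> Xi_graph b c eps r y <-> y = Xi_tilde b c eps r.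
Proof.
  intros r0.
  assert (H : Xi_graph b c eps r (Xi_tilde b c eps r)).
  { unfold Xi_tilde; apply epsilon_spec, Xi_graph_exists, r0. }
  split; [intros K; exact (Xi_graph_unique _ _ _ _ _ _ K H)|now intros ->].
Qed.

(* Main.v *)
(* The triangle inequality shows that sigma_n minimizes the n-th functional as soon as
   N(sigma_n) = h_n and N lies below
     U_n(x) = h_n + c^-n (|x| - r_n) - b^-n |x - sigma_n|.
   So one takes for N the minimum of Xi and of the U_n over the odd n > 2 nbar, at which
   the direction turns. With gap_n = 1 - r_n and w_n = c^-n + b^-n one has
   1 - h_n = (9/16) w_(n+1) gap_n and w_(n+1) <= w_n / 9. Hence Xi lies below the line of
   slope w_n through (r_n, h_n), up to the value 1; this settles the steps that keep the
   direction. It also gives Xi <= U_n off the annulus s_(n-1) < |x| < s_n once (b/2c)^n is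
   at least 64, so the minimum changes Xi only where admissibility leaves freedom, and
   each U_n still attains h_n at sigma_n. *)
Require Import Defs.
From Stdlib Require Import Reals Lra Lia ClassicalEpsilon.
From Coquelicot Require Import Coquelicot.
Open Scope R_scope.

(** * The radii [r_] and [s_], and the Euclidean norm of the plane *)

Definition gap (n : nat) : R := (1 / 2) ^ (n + 1).

Lemma gap_pos (n : nat) : 0 < gap n.
Proof. apply pow_lt; lra. Qed.

Lemma gap_succ (n : nat) : gap (n + 1) = gap n / 2.
Proof. unfold gap; rewrite (pow_add _ (n + 1) 1); simpl; field. Qed.

Lemma r_gap (n : nat) : r_ n = 1 - gap n.
Proof. apply r_E. Qed.

Lemma s_gap (n : nat) : s_ n = 1 - gap n + gap n / 4.
Proof. unfold s_; rewrite !r_gap, gap_succ; field. Qed.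

Lemma s_le_r (m n : nat) : (m < n)%nat -> s_ m <= r_ n.
Proof.
  intros mn; generalize (s_lt_r m) (r_le (m + 1) n ltac:(lia)); lra.
Qed.

Lemma r_pos (n : nat) : 0 < r_ n.
Proof.
  generalize (r_le 0 n ltac:(lia)); rewrite (r_gap 0); unfold gap; simpl; lra.
Qed.

Lemma r_exceeds (r : R) : r < 1 -> exists n, r < r_ n.
Proof.
  intros r1; destruct (pow_lt_1_zero (1 / 2)) with (y := 1 - r) as [n Hn].
  - rewrite Rabs_pos_eq; lra.
  - lra.
  - exists n; rewrite r_gap; specialize (Hn (n + 1)%nat ltac:(lia)); fold (gap n) in Hn.
    rewrite Rabs_pos_eq in Hn; generalize (gap_pos n); lra.
Qed.

(* Restatements of Coquelicot's lemmas at the plane: the generic ones carry a different,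
   only convertible, group structure, which [lra] does not identify. *)
Lemma norm_minus_ge (x y : R * R) : Rabs (norm x - norm y) <= norm (minus x y).
Proof. exact (norm_triangle_inv x y). Qed.

Lemma norm_minus_le (x y : R * R) : norm (minus x y) <= norm x + norm y.
Proof. rewrite <- (norm_opp y); exact (norm_triangle x (opp y)). Qed.

Lemma norm_minus_diag (x : R * R) : norm (minus x x) = 0.
Proof. rewrite minus_eq_zero; exact norm_zero. Qed.

Lemma minus_minus (x y q : R * R) : minus (minus x q) (minus y q) = minus x y.
Proof. destruct x, y, q; cbv; f_equal; ring. Qed.

Lemma lipschitz_continuous (f : R * R -> R) : lipschitz f -> forall x, continuous f x.
Proof.
  intros [L HL] x; apply filterlim_locally; intros e.
  (* Neighbourhoods in the product are built from squares; this passes to Euclidean balls. The [+ 1]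
     below covers a constant [L] that is zero or negative. *)
  apply (locally_le_locally_norm (V := prod_NormedModule R_AbsRing R_NormedModule R_NormedModule)).
  assert (P : 0 < e / (Rabs L + 1)).
  { apply Rdiv_lt_0_compat; [apply e|generalize (Rabs_pos L); lra]. }
  exists (mkposreal _ P); intros y Hy.
  change (norm (minus (y : R * R) (x : R * R)) < e / (Rabs L + 1)) in Hy.
  apply (Rle_lt_trans _ _ _ (HL y x)).
  assert (LL := Rle_abs L); assert (L0 := Rabs_pos L).
  assert (nn : 0 <= norm (minus (y : R * R) (x : R * R))) by exact (norm_ge_0 _).
  apply Rlt_div_r in Hy; [|lra].
  eapply Rle_lt_trans; [|exact Hy]; nra.
Qed.

(** * The weights and the heights [h_] *)

Section Radial.

Context (b c eps : R) (hc : c >= 9) (hbc : b / c > 2) (heps : eps > 0).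

Definition weight (n : nat) : R := (/ c) ^ n + (/ b) ^ n.

Lemma b_ge_18 : 18 <= b.
Proof.
  replace b with (b / c * c) by (field; lra).
  generalize (Rmult_le_compat_r c 2 (b / c) ltac:(lra) ltac:(lra)); lra.
Qed.

Lemma invc_pow_pos (n : nat) : 0 < (/ c) ^ n.
Proof. apply pow_lt, Rinv_0_lt_compat; lra. Qed.

Lemma invb_pow_pos (n : nat) : 0 < (/ b) ^ n.
Proof. generalize b_ge_18; intros; apply pow_lt, Rinv_0_lt_compat; lra. Qed.

Lemma invb_pow_le (n : nat) : (/ b) ^ n <= (/ c) ^ n.
Proof.
  assert (hb18 := b_ge_18).
  assert (c <= b).
  { replace b with (b / c * c) by (field; lra).
    generalize (Rmult_le_compat_r c 1 (b / c) ltac:(lra) ltac:(lra)); lra. }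
  apply pow_incr; split; [left; apply Rinv_0_lt_compat|apply Rinv_le_contravar]; lra.
Qed.

Lemma weight_succ (n : nat) : 0 < weight (n + 1) <= weight n / 9.
Proof.
  unfold weight; generalize (invc_pow_pos (n + 1)) (invb_pow_pos (n + 1)).
  rewrite !pow_add, !pow_1; intros.
  assert (hb18 := b_ge_18).
  assert (/ c <= / 9) by (apply Rinv_le_contravar; lra).
  assert (/ b <= / 9) by (apply Rinv_le_contravar; lra).
  generalize (invc_pow_pos n) (invb_pow_pos n); intros.
  generalize (Rmult_le_compat_l ((/ c) ^ n) (/ c) (/ 9) ltac:(lra) ltac:(assumption)).
  generalize (Rmult_le_compat_l ((/ b) ^ n) (/ b) (/ 9) ltac:(lra) ltac:(assumption)).
  split; lra.
Qed.

Lemma weight_le (n : nat) : weight (n + 1) <= 2 / 9.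
Proof.
  induction n as [|n IH].
  - generalize (weight_succ 0); unfold weight; simpl; lra.
  - rewrite <- (Nat.add_1_r n); generalize (weight_succ (n + 1)); lra.
Qed.

Lemma h_weight (n : nat) : h_ b c n = 1 - 9 / 16 * (weight (n + 1) * gap n).
Proof.
  assert (hb18 := b_ge_18).
  unfold h_, weight, gap; replace (1 / 2) with (/ 2) by lra.
  rewrite !pow_inv; replace (n + 2)%nat with (n + 1 + 1)%nat by lia.
  rewrite (pow_add 2 (n + 1) 1).
  field; repeat split; apply pow_nonzero; lra.
Qed.

(** The 1/16 is the 9/16 of [h_weight] times the decay 1/9 of the weights. *)
Lemma h_bounds (n : nat) : 1 - weight n * gap n / 16 <= h_ b c n < 1.
Proof.
  rewrite h_weight; assert (g := gap_pos n); destruct (weight_succ n) as [w1 w2].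
  generalize (Rmult_lt_0_compat _ _ w1 g) (Rmult_le_compat_r _ _ _ (Rlt_le _ _ g) w2); lra.
Qed.

(* This is where the factor 9/8 > 1 and [c >= 9] enter. *)
Lemma h_chord (n : nat) :
  h_ b c n <= h_ b c (n + 1) - weight (n + 1) * gap (n + 1)
              - weight (n + 1) * gap (n + 1) / 16.
Proof.
  (* In units of [weight (n + 1) * gap (n + 1)], 1 - h_n equals 9/8 and 1 - h_(n+1) is at most 1/16,
     so the rise is at least 17/16. *)
  generalize (h_bounds (n + 1)); rewrite (h_weight n), gap_succ.
  intros; nra.
Qed.

Lemma h_lt (n : nat) : h_ b c n < h_ b c (n + 1).
Proof.
  generalize (h_chord n) (Rmult_lt_0_compat _ _ (proj1 (weight_succ n)) (gap_pos (n + 1))).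
  lra.
Qed.

(** * The radial profile and the lines above it *)

Notation X := (Xi_tilde b c eps).

Lemma Xi_tilde_inner (r : R) :
  0 <= r <= r_ 0 -> X r = h_ b c 0 + 2 * (r - r_ 0) - eps * (r - r_ 0) ^ 2.
Proof.
  intros H; symmetry; apply Xi_tildeP; [lra|]; left; auto.
Qed.

Lemma Xi_tilde_flat (n : nat) (r : R) : r_ n <= r <= s_ n -> X r = h_ b c n.
Proof.
  intros H; symmetry; apply Xi_tildeP; [generalize (r_pos n); lra|].
  right; left; eauto.
Qed.

Lemma Xi_tilde_ramp (n : nat) (r : R) : s_ n <= r <= r_ (n + 1) ->
  X r = h_ b c n + (h_ b c (n + 1) - h_ b c n) / (r_ (n + 1) - s_ n) * (r - s_ n).
Proof.
  intros H; symmetry; apply Xi_tildeP; [generalize (r_pos n) (r_lt_s n); lra|].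
  right; right; left; eauto.
Qed.

Lemma Xi_tilde_outer (r : R) : 1 <= r -> X r = 1 + 2 * (r - 1).
Proof.
  intros H; symmetry; apply Xi_tildeP; [lra|]; right; right; right; auto.
Qed.

Lemma Xi_tilde_r (n : nat) : X (r_ n) = h_ b c n.
Proof. apply Xi_tilde_flat; generalize (r_lt_s n); lra. Qed.

(** On the flat piece the nondecreasing line is already above h_n at its left end; on the ramp both
    sides are affine, so the end points decide. *)
Lemma Xi_tilde_le_affine (n : nat) (u v r : R) :
  0 <= v -> h_ b c n <= u + v * r_ n -> h_ b c (n + 1) <= u + v * r_ (n + 1) ->
  r_ n <= r <= r_ (n + 1) -> X r <= u + v * r.
Proof.
  intros v0 Hl Hr Hn; assert (rs := r_lt_s n); assert (sr := s_lt_r n).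
  destruct (Rle_dec r (s_ n)) as [le|gt].
  - rewrite (Xi_tilde_flat n) by lra; nra.
  - rewrite (Xi_tilde_ramp n) by lra.
    set (t := (r - s_ n) / (r_ (n + 1) - s_ n)).
    assert (et : r = s_ n + t * (r_ (n + 1) - s_ n)) by (unfold t; field; lra).
    assert (0 <= t <= 1).
    { unfold t; split; [apply Rdiv_le_0_compat|apply Rle_div_l]; lra. }
    replace (_ / _ * _) with (t * (h_ b c (n + 1) - h_ b c n))
      by (unfold t; field; lra).
    assert (h_ b c n <= u + v * s_ n) by nra.
    rewrite et; nra.
Qed.

Lemma Xi_tilde_ge_h (n : nat) (r : R) : r_ n <= r <= r_ (n + 1) -> h_ b c n <= X r.
Proof.
  intros Hn; assert (rs := r_lt_s n); assert (sr := s_lt_r n); assert (hl := h_lt n).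
  destruct (Rle_dec r (s_ n)) as [le|gt].
  - rewrite (Xi_tilde_flat n); lra.
  - rewrite (Xi_tilde_ramp n) by lra.
    assert (0 <= (h_ b c (n + 1) - h_ b c n) / (r_ (n + 1) - s_ n) * (r - s_ n)); [|lra].
    apply Rmult_le_pos; [apply Rdiv_le_0_compat|]; lra.
Qed.

(** The slope is the weight of the following step, so that [h_chord] prolongs the line to the next
    vertex. In the induction this prolonged line is steeper than the one wanted, hence lower to the
    left of the vertex. *)
Lemma Xi_tilde_le_chord (n : nat) (r : R) :
  0 <= r <= r_ n -> X r <= h_ b c n - weight (n + 1) * (r_ n - r).
Proof.
  revert r; induction n as [|n IH]; intros r Hr.
  - rewrite Xi_tilde_inner by lra.
    generalize (weight_le 0) (pow2_ge_0 (r - r_ 0)); simpl (0 + 1)%nat; intros.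
    assert (0 <= eps * (r - r_ 0) ^ 2) by (apply Rmult_le_pos; lra).
    nra.
  - rewrite <- (Nat.add_1_r n) in *.
    assert (hw := weight_succ (n + 1)); assert (hch := h_chord n).
    assert (hw' := weight_succ n); assert (g := gap_pos (n + 1)).
    assert (er : r_ (n + 1) - r_ n = gap (n + 1)) by (rewrite !r_gap, !gap_succ; lra).
    destruct (Rle_dec r (r_ n)).
    + specialize (IH r ltac:(lra)); nra.
    + replace (h_ b c (n + 1) - _) with
        (h_ b c (n + 1) - weight (n + 1 + 1) * r_ (n + 1) + weight (n + 1 + 1) * r) by ring.
      apply (Xi_tilde_le_affine n); nra.
Qed.

Lemma Xi_tilde_lt1 (r : R) : 0 <= r < 1 -> X r < 1.
Proof.
  intros Hr; destruct (r_exceeds r) as [n Hn]; [lra|].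
  assert (H := Xi_tilde_le_chord n r ltac:(lra)).
  generalize (h_bounds n) (weight_succ n); nra.
Qed.

(** * Radial inequalities behind the straight steps and the turning steps *)

Lemma Xi_tilde_aligned_first (r : R) :
  0 <= r -> Rmin (X r) 1 <= h_ b c 0 + 2 * (r - r_ 0).
Proof.
  intros Hr; destruct (Rle_dec r (r_ 0)) as [l0|g0].
  - eapply Rle_trans; [apply Rmin_l|].
    rewrite Xi_tilde_inner by lra.
    generalize (pow2_ge_0 (r - r_ 0)); intros; nra.
  - destruct (Rle_dec r (s_ 0)).
    + eapply Rle_trans; [apply Rmin_l|]; rewrite (Xi_tilde_flat 0); lra.
    (* Past s_0 the right side is at least h_0 + 1/4, while 1 - h_0 is at most 1/16. *)
    + eapply Rle_trans; [apply Rmin_r|].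
      generalize (h_bounds 0); rewrite r_gap; rewrite s_gap in *.
      unfold weight, gap in *; simpl in *; lra.
Qed.

(** One-variable form of the optimality bound when the direction is kept, with |x - sigma_n|
    replaced by its lower bound | |x| - r_n |. The cap at 1 is available because 1 - |1 - N| never
    exceeds 1. For r >= r_n the right side is the line of slope [weight (n + 1)] through the vertex
    (r_(n+1), h_(n+1)). *)
Lemma Xi_tilde_aligned (n : nat) (r : R) :
  0 <= r ->
  Rmin (X r) 1 <= h_ b c (n + 1) + (/ c) ^ (n + 1) * (r - r_ (n + 1))
                  + (/ b) ^ (n + 1) * (Rabs (r - r_ n) - gap (n + 1)).
Proof.
  intros Hr.
  assert (hch := h_chord n); assert (hb := h_bounds (n + 1)); assert (hw := weight_succ n).
  assert (g := gap_pos (n + 1)).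
  assert (er : r_ (n + 1) - r_ n = gap (n + 1)) by (rewrite !r_gap, !gap_succ; lra).
  assert (Pb := invb_pow_pos (n + 1)); assert (Pc := invc_pow_pos (n + 1)).
  assert (bc := invb_pow_le (n + 1)).
  assert (Q := Xi_tilde_le_chord n r).
  assert (ew : weight (n + 1) = (/ c) ^ (n + 1) + (/ b) ^ (n + 1)) by reflexivity.
  destruct (Rle_dec r (r_ n)) as [l0|g0].
  - eapply Rle_trans; [apply Rmin_l|].
    rewrite (Rabs_left1 (r - r_ n)) by lra.
    specialize (Q ltac:(lra)); nra.
  - rewrite (Rabs_pos_eq (r - r_ n)) by lra.
    replace (_ + _ * (r - r_ n - _)) with
      (h_ b c (n + 1) - weight (n + 1) * r_ (n + 1) + weight (n + 1) * r)
      by (rewrite ew; nra).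
    destruct (Rle_dec r (r_ (n + 1))).
    + eapply Rle_trans; [apply Rmin_l|]; apply (Xi_tilde_le_affine n); nra.
    + destruct (Rle_dec r (s_ (n + 1))).
      * eapply Rle_trans; [apply Rmin_l|]; rewrite (Xi_tilde_flat (n + 1)) by lra; nra.
      (* Here the line has risen by at least [weight (n + 1) * gap (n + 1) / 4], four times the
         bound on 1 - h_(n+1). *)
      * eapply Rle_trans; [apply Rmin_r|].
        assert (gap (n + 1) / 4 <= r - r_ (n + 1)) by (rewrite r_gap; rewrite s_gap in *; lra).
        nra.
Qed.

(* [step_large n]: n is so large that a rotation at step n costs less than leaving
   the optimal radius. *)
Definition step_large (n : nat) : Prop := 32 * (/ b) ^ n <= (/ c) ^ n * gap n.

(* [peak] without its last term, with [norm (minus x q)] replaced by its largest value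
   for [norm q = r_ n]. *)
Definition far_bound (n : nat) (r : R) : R :=
  h_ b c n + (/ c) ^ n * (r - r_ n) - (/ b) ^ n * (r + r_ n).

(** The 32 of [step_large] comes from here: inside the disc the subtracted distance term is at most
    2 b^-(n+1), and it has to be absorbed by the last sixteenth in [h_chord]. *)
Lemma far_bound_ge_h (n : nat) (r : R) :
  step_large (n + 1) -> r_ n <= r <= 1 -> h_ b c n <= far_bound (n + 1) r.
Proof.
  unfold step_large, far_bound; intros large Hr.
  assert (hch := h_chord n); assert (g := gap_pos (n + 1)).
  assert (er : r_ (n + 1) - r_ n = gap (n + 1)) by (rewrite !r_gap, !gap_succ; lra).
  assert (Pb := invb_pow_pos (n + 1)); assert (Pc := invc_pow_pos (n + 1)).
  assert (ew : weight (n + 1) = (/ c) ^ (n + 1) + (/ b) ^ (n + 1)) by reflexivity.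
  assert (r1 := r_lt1 (n + 1)). rewrite ew in *.
  set (B := (/ b) ^ (n + 1)) in *. set (C := (/ c) ^ (n + 1)) in *.
  assert (B * (r + r_ (n + 1)) <= B * 2) by (apply Rmult_le_compat_l; lra).
  assert (- gap (n + 1) * C <= C * (r - r_ (n + 1))) by nra.
  assert (0 < B * gap (n + 1)) by nra.
  lra.
Qed.

(** Left of r_n the chord bounding the profile has slope C + B, with C = c^-(n+1) and B = b^-(n+1),
    while [far_bound] has slope C - B, so comparing at r_n is enough. Right of s_(n+1) the bound
    exceeds 1. *)
Lemma far_bound_ge_Xi_tilde (n : nat) (r : R) :
  step_large (n + 1) -> 0 <= r -> r <= s_ n \/ s_ (n + 1) <= r ->
  Rmin (X r) 1 <= far_bound (n + 1) r.
Proof.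
  intros large Hr H.
  assert (Pb := invb_pow_pos (n + 1)); assert (Pc := invc_pow_pos (n + 1)).
  assert (bc := invb_pow_le (n + 1)).
  assert (rp := r_pos n). assert (r1 := r_lt1 n). assert (r1' := r_lt1 (n + 1)).
  assert (sr := s_lt_r n).
  destruct H as [H|H].
  - eapply Rle_trans; [apply Rmin_l|].
    destruct (Rle_dec r (r_ n)).
    + assert (F := far_bound_ge_h n (r_ n) large ltac:(lra)).
      assert (Q := Xi_tilde_le_chord n r ltac:(lra)).
      revert F Q; unfold far_bound, weight; intros; nra.
    + rewrite (Xi_tilde_flat n) by lra; apply far_bound_ge_h; [assumption|lra].
  - eapply Rle_trans; [apply Rmin_r|].
    assert (hb := h_bounds (n + 1)); assert (g := gap_pos (n + 1)).
    unfold far_bound; unfold step_large in large.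
    assert (hw := weight_succ (n + 1)).
    assert (ew : weight (n + 1) = (/ c) ^ (n + 1) + (/ b) ^ (n + 1)) by reflexivity.
    rewrite s_gap in H; rewrite r_gap in *.
    set (B := (/ b) ^ (n + 1)) in *. set (C := (/ c) ^ (n + 1)) in *.
    set (d := gap (n + 1)) in *. rewrite ew in *.
    assert (B * d <= C * d) by (apply Rmult_le_compat_r; lra).
    (* [far_bound] is nondecreasing, so only r = s_(n+1) matters; there the gain C d / 4 pays for 1
       - h_(n+1) <= C d / 8 and for the distance term, at most 2 B. *)
    assert (0 <= (C - B) * (r - (1 - d + d / 4))) by (apply Rmult_le_pos; lra).
    nra.
Qed.

(** * Lipschitz continuity of the profile and of [Xi] *)

Lemma Xi_tilde_lipschitz_r (n : nat) (r t : R) :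
  0 <= r -> r <= t <= r_ n -> Rabs (X t - X r) <= (2 + eps) * (t - r).
Proof.
  revert r t; induction n as [|n IH]; intros r t r0 rt.
  - rewrite !Xi_tilde_inner by lra.
    replace (_ - _) with ((t - r) * (2 + eps * (2 * r_ 0 - t - r))) by ring.
    (* The steepest inner slope is 2 + 2 eps r_0, at the origin; this is where 2 + eps comes
       from. *)
    assert (r_ 0 = 1 / 2) by (rewrite r_gap; unfold gap; simpl; lra).
    rewrite Rabs_pos_eq by (apply Rmult_le_pos; [|apply Rplus_le_le_0_compat]; nra).
    rewrite Rmult_comm; apply Rmult_le_compat_r; nra.
  - rewrite <- (Nat.add_1_r n) in rt.
    assert (rs := r_lt_s n); assert (sr := s_lt_r n); assert (g := gap_pos n).
    assert (hl := h_lt n); assert (hb := h_bounds (n + 1)); assert (rp := r_pos n).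
    assert (flat : forall r t, r_ n <= r -> r <= t <= s_ n ->
      Rabs (X t - X r) <= (2 + eps) * (t - r)).
    { intros u v u0 uv; rewrite !(Xi_tilde_flat n) by lra.
      rewrite Rminus_diag, Rabs_R0; nra. }
    assert (ramp : forall r t, s_ n <= r -> r <= t <= r_ (n + 1) ->
      Rabs (X t - X r) <= (2 + eps) * (t - r)).
    { intros u v u0 uv; rewrite !(Xi_tilde_ramp n) by lra.
      assert (er : r_ (n + 1) - s_ n = gap n / 4) by (rewrite r_gap, s_gap, gap_succ; lra).
      assert (hn := h_weight n); assert (hw := weight_le n); assert (hw' := weight_succ n).
      set (k := (h_ b c (n + 1) - h_ b c n) / (r_ (n + 1) - s_ n)).
      (* The ramp rises by less than 1 - h_n over a length gap_n / 4, so k < (9/4) w_(n+1) <=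
         1/2. *)
      assert (0 <= k <= 2).
      { unfold k; split; [apply Rdiv_le_0_compat; lra|apply Rle_div_l; [lra|]].
        rewrite er, hn; nra. }
      replace (_ - _) with (k * (v - u)) by ring.
      rewrite Rabs_pos_eq by nra; apply Rmult_le_compat_r; lra. }
    assert (glue : forall m u v, u <= m <= v ->
      Rabs (X m - X u) <= (2 + eps) * (m - u) ->
      Rabs (X v - X m) <= (2 + eps) * (v - m) ->
      Rabs (X v - X u) <= (2 + eps) * (v - u)).
    { intros m u v umv H1 H2; generalize (Rabs_triang (X v - X m) (X m - X u)).
      replace (X v - X m + (X m - X u)) with (X v - X u) by ring; lra. }
    assert (upper : forall r t, r_ n <= r -> r <= t <= r_ (n + 1) ->
      Rabs (X t - X r) <= (2 + eps) * (t - r)).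
    { intros u v u0 uv.
      destruct (Rle_dec v (s_ n)); [apply flat; lra|].
      destruct (Rle_dec (s_ n) u); [apply ramp; lra|].
      apply (glue (s_ n)); [lra|apply flat; lra|apply ramp; lra]. }
    destruct (Rle_dec t (r_ n)); [apply IH; lra|].
    destruct (Rle_dec (r_ n) r); [apply upper; lra|].
    apply (glue (r_ n)); [lra|apply IH; lra|apply upper; lra].
Qed.

Lemma Xi_tilde_lipschitz (r t : R) :
  0 <= r <= t -> Rabs (X t - X r) <= (2 + eps) * (t - r).
Proof.
  intros rt; destruct (Rlt_dec t 1) as [t1|t1].
  - destruct (r_exceeds t t1) as [n Hn]; apply (Xi_tilde_lipschitz_r n); lra.
  - rewrite (Xi_tilde_outer t) by lra.
    destruct (Rlt_dec r 1) as [r1|r1].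
    + destruct (r_exceeds r r1) as [n Hn].
      (* The induction never reaches radius 1. The remaining jump from h_n to 1 is bounded by gap_n
         = 1 - r_n, that is, by slope 1. *)
      assert (L := Xi_tilde_lipschitz_r n r (r_ n) ltac:(lra) ltac:(lra)).
      assert (lt := Xi_tilde_lt1 r ltac:(lra)).
      assert (hn := h_weight n); assert (hw := weight_le n).
      assert (hw' := weight_succ n); assert (g := gap_pos n).
      rewrite Xi_tilde_r in L; assert (rn := r_gap n).
      apply Rabs_le_between in L; rewrite Rabs_pos_eq by lra.
      assert (weight (n + 1) * gap n <= gap n) by nra.
      assert (0 <= eps * (1 - r_ n)) by nra.
      assert (0 <= eps * (t - 1)) by nra.
      lra.
    + rewrite (Xi_tilde_outer r) by lra.
      replace (_ - _) with (2 * (t - r)) by ring; rewrite Rabs_pos_eq; nra.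
Qed.

Lemma Xi_lipschitz (x y : R * R) :
  Rabs (Xi b c eps x - Xi b c eps y) <= (2 + eps) * norm (minus x y).
Proof.
  unfold Xi; assert (T := norm_minus_ge x y).
  apply Rle_trans with ((2 + eps) * Rabs (norm x - norm y)); [|apply Rmult_le_compat_l; lra].
  assert (nx := norm_ge_0 x); assert (ny := norm_ge_0 y).
  destruct (Rle_dec (norm x) (norm y)).
  - rewrite Rabs_minus_sym, (Rabs_left1 (norm x - norm y)) by lra.
    rewrite Ropp_minus_distr; apply Xi_tilde_lipschitz; lra.
  - rewrite (Rabs_pos_eq (norm x - norm y)) by lra; apply Xi_tilde_lipschitz; lra.
Qed.

(** * The peaks U_n and the criterion for optimality *)

(* The last term keeps the peaks above [Xi], which grows with slope 2, outside the disc. *)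
Definition peak (q : R * R) (n : nat) (x : R * R) : R :=
  h_ b c n + (/ c) ^ n * (norm x - r_ n) - (/ b) ^ n * norm (minus x q)
  + 2 * Rmax 0 (norm x - 1).

Lemma peak_lipschitz (q : R * R) (n : nat) (x y : R * R) :
  peak q n x - peak q n y <= 4 * norm (minus x y).
Proof.
  assert (T := norm_minus_ge x y).
  assert (T' := norm_minus_ge (minus x q) (minus y q)).
  rewrite minus_minus in T'.
  apply Rabs_le_between in T; apply Rabs_le_between in T'.
  assert (Pb := invb_pow_pos n); assert (Pc := invc_pow_pos n).
  assert (bc := invb_pow_le n).
  assert ((/ c) ^ n <= 1).
  { rewrite pow_inv, <- Rinv_1; apply Rinv_le_contravar; [lra|apply pow_R1_Rle; lra]. }
  assert (0 <= norm (minus x y)) by exact (norm_ge_0 _).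
  assert (Rmax 0 (norm x - 1) - Rmax 0 (norm y - 1) <= norm (minus x y)).
  { unfold Rmax; destruct (Rle_dec 0 (norm x - 1)), (Rle_dec 0 (norm y - 1)); lra. }
  assert ((/ c) ^ n * (norm x - norm y) <= norm (minus x y)) by nra.
  assert ((/ b) ^ n * (norm (minus y q) - norm (minus x q)) <= norm (minus x y)) by nra.
  unfold peak; lra.
Qed.

Lemma peak_ge_far_bound (q x : R * R) (n : nat) :
  norm q = r_ n -> far_bound n (norm x) + 2 * Rmax 0 (norm x - 1) <= peak q n x.
Proof.
  intros nq; unfold peak, far_bound.
  assert (norm (minus x q) <= norm x + r_ n).
  { rewrite <- nq; apply norm_minus_le. }
  generalize (invb_pow_pos n); nra.
Qed.

Lemma peak_ge_Xi (q x : R * R) (n : nat) :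
  norm q = r_ (n + 1) -> step_large (n + 1) -> norm x <= s_ n \/ s_ (n + 1) <= norm x ->
  Xi b c eps x <= peak q (n + 1) x.
Proof.
  intros nq large H; eapply Rle_trans; [|apply peak_ge_far_bound, nq].
  assert (nx := norm_ge_0 x).
  assert (F := far_bound_ge_Xi_tilde n (norm x) large nx H); unfold Xi.
  destruct (Rlt_dec (norm x) 1) as [x1|x1].
  - generalize (Xi_tilde_lt1 (norm x) ltac:(lra)) (Rmax_l 0 (norm x - 1)); intros.
    rewrite Rmin_left in F; lra.
  (* Outside the disc [far_bound] is at least 1, and the last term of the peak supplies exactly the
     excess of [Xi] over 1. *)
  - rewrite Xi_tilde_outer in * by lra; rewrite Rmin_right in F by lra.
    rewrite Rmax_right; lra.
Qed.

(* Scaling the functional at step n by [b ^ - n] turns optimality of [z] into the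
   pointwise bound [H]. *)
Lemma minimizer_criterion (N : R * R -> R) (n : nat) (z p : R * R) :
  N z = h_ b c n -> norm z = r_ n ->
  (forall x, 1 - Rabs (1 - N x) <=
     h_ b c n + (/ c) ^ n * (norm x - r_ n)
     + (/ b) ^ n * (norm (minus x p) - norm (minus z p))) ->
  is_minimizer (fun x => b ^ n * Rabs (1 - N x) + (b / c) ^ n * norm x
                         + norm (minus x p)) z.
Proof.
  intros Nz nz H x; specialize (H x).
  assert (hb18 := b_ge_18); assert (hb := h_bounds n).
  assert (Pb : 0 < b ^ n) by (apply pow_lt; lra).
  rewrite Nz, nz, Rabs_pos_eq by lra.
  unfold Rdiv; rewrite Rpow_mult_distr.
  apply (Rmult_le_compat_l (b ^ n)) in H; [|lra].
  assert (e : b ^ n * (/ b) ^ n = 1) by (rewrite <- Rpow_mult_distr, Rinv_r, pow1; lra).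
  rewrite !Rmult_plus_distr_l, <- (Rmult_assoc (b ^ n) ((/ b) ^ n)), e in H.
  lra.
Qed.

Lemma step_large_eventually : exists m, (1 <= m)%nat /\ forall n, (m <= n)%nat -> step_large n.
Proof.
  assert (hb18 := b_ge_18).
  (* 64 is the 32 of [step_large] times the extra factor 2 from the exponent n + 1 in [gap]; the
     base exceeds 1 because b/c > 2. *)
  destruct (Pow_x_infinity (b / c / 2)) with (b := 64) as [m Hm].
  { rewrite Rabs_pos_eq; lra. }
  exists (S m); split; [lia|]; intros n mn; specialize (Hm n ltac:(lia)).
  rewrite Rabs_pos_eq in Hm by (apply pow_le; lra).
  unfold step_large, gap; rewrite pow_add, pow_1.
  assert (e : (/ c) ^ n * (1 / 2) ^ n = (/ b) ^ n * (b / c / 2) ^ n).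
  { rewrite <- !Rpow_mult_distr; f_equal; field; lra. }
  rewrite <- Rmult_assoc, e; generalize (invb_pow_pos n); nra.
Qed.

(** * The function N as the lower envelope of [Xi] and the peaks *)

Section Peaks.

Context (nbar : nat) (sigma : nat -> R * R).
Context (norm_sigma : forall n, norm (sigma n) = r_ n).
Context (large : forall n, (nbar <= n)%nat -> step_large n).

(** The direction turns only on entering an odd index, so only those points carry a peak. The
    envelope depends on [sigma] through norms alone until [minimizer_aligned]. *)
Let pk (k : nat) : R * R -> R := peak (sigma (2 * k + 1)) (2 * k + 1).

Lemma peak_off_annulus (k : nat) (x : R * R) :
  (nbar <= k)%nat -> norm x <= s_ (2 * k) \/ s_ (2 * k + 1) <= norm x ->
  Xi b c eps x <= pk k x.
Proof. intros nk H; apply peak_ge_Xi; [apply norm_sigma|apply large; lia|exact H]. Qed.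

(* The infimum of [Xi] and the peaks is attained, because at most one peak lies below
   [Xi] at a given point. *)
Definition lower_value (x : R * R) (y : R) : Prop :=
  y <= Xi b c eps x /\ (forall k, (nbar <= k)%nat -> y <= pk k x) /\
  (y = Xi b c eps x \/ exists k, (nbar <= k)%nat /\ y = pk k x).

Lemma lower_value_exists (x : R * R) : exists y, lower_value x y.
Proof.
  destruct (classic (exists k, (nbar <= k)%nat /\ pk k x < Xi b c eps x)) as [[k [nk lt]]|no].
  - exists (pk k x); split; [lra|]; split; [|right; exists k; auto].
    intros j nj; destruct (Nat.eq_dec j k) as [->|ne]; [lra|].
    assert (inside : s_ (2 * k) < norm x < s_ (2 * k + 1)).
    { split; apply Rnot_le_lt; intros H; generalize (peak_off_annulus k x nk); lra. }
    (* The annuli of distinct peaks are disjoint, so x lies off that of peak j. *)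
    enough (Xi b c eps x <= pk j x) by lra.
    apply peak_off_annulus; [exact nj|].
    destruct (Nat.lt_ge_cases j k).
    + right; generalize (s_le_r (2 * j + 1) (2 * k) ltac:(lia)) (r_lt_s (2 * k)); lra.
    + left; generalize (s_le_r (2 * k + 1) (2 * j) ltac:(lia)) (r_lt_s (2 * j)); lra.
  - exists (Xi b c eps x); split; [lra|]; split; [|left; reflexivity].
    intros k nk; apply Rnot_lt_le; intros lt; apply no; exists k; auto.
Qed.

Definition peaked (x : R * R) : R := epsilon (inhabits 0) (lower_value x).

Lemma peakedP (x : R * R) : lower_value x (peaked x).
Proof. exact (epsilon_spec (inhabits 0) (lower_value x) (lower_value_exists x)). Qed.

Lemma peaked_le_Xi (x : R * R) : peaked x <= Xi b c eps x.
Proof. apply peakedP. Qed.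

Lemma peaked_le_peak (k : nat) (x : R * R) : (nbar <= k)%nat -> peaked x <= pk k x.
Proof. apply peakedP. Qed.

Lemma peaked_cases (x : R * R) :
  peaked x = Xi b c eps x \/ exists k, (nbar <= k)%nat /\ peaked x = pk k x.
Proof. apply peakedP. Qed.

(** The function attaining the envelope at y also bounds it from above at x, so the envelope
    inherits the common Lipschitz constant 4 + eps. *)
Lemma peaked_lipschitz : lipschitz peaked.
Proof.
  assert (one : forall x y, peaked x - peaked y <= (4 + eps) * norm (minus x y)).
  { intros x y; assert (0 <= norm (minus x y)) by exact (norm_ge_0 _).
    destruct (peaked_cases y) as [->|[k [nk ->]]].
    - generalize (peaked_le_Xi x) (Xi_lipschitz x y) (Rle_abs (Xi b c eps x - Xi b c eps y)).
      nra.
    - generalize (peaked_le_peak k x nk)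
        (peak_lipschitz (sigma (2 * k + 1)) (2 * k + 1) x y); fold (pk k).
      nra. }
  exists (4 + eps); intros x y; apply Rabs_le; split; [|apply one].
  assert (T := one y x).
  replace (norm (minus y x)) with (norm (minus x y)) in T; [lra|].
  rewrite <- (opp_minus x y); symmetry; exact (norm_opp (minus x y)).
Qed.

Lemma peaked_eq_Xi (x : R * R) :
  (forall k, (nbar <= k)%nat -> norm x <= s_ (2 * k) \/ s_ (2 * k + 1) <= norm x) ->
  peaked x = Xi b c eps x.
Proof.
  intros off; apply Rle_antisym; [apply peaked_le_Xi|].
  destruct (peaked_cases x) as [->|[k [nk ->]]]; [lra|].
  apply peak_off_annulus; auto.
Qed.

(** A point with a peak is its apex, of height h_n; every other peak is at least [Xi] there, because
    r_n lies off its annulus. *)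
Lemma peaked_sigma (n : nat) : peaked (sigma n) = h_ b c n.
Proof.
  assert (e : Xi b c eps (sigma n) = h_ b c n).
  { unfold Xi; rewrite norm_sigma; apply Xi_tilde_r. }
  apply Rle_antisym; [rewrite <- e; apply peaked_le_Xi|].
  destruct (peaked_cases (sigma n)) as [->|[k [nk ->]]]; [lra|].
  destruct (Nat.eq_dec n (2 * k + 1)) as [->|ne].
  - unfold pk, peak; rewrite norm_sigma, norm_minus_diag.
    rewrite Rmax_left; [lra|generalize (r_lt1 (2 * k + 1)); lra].
  - rewrite <- e; apply peak_off_annulus; [exact nk|]; rewrite norm_sigma.
    destruct (Nat.lt_ge_cases n (2 * k + 1)).
    + left; generalize (r_le n (2 * k) ltac:(lia)) (r_lt_s (2 * k)); lra.
    + right; apply s_le_r; lia.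
Qed.

Lemma peaked_outer (x : R * R) : 1 <= norm x -> peaked x = Xi b c eps x.
Proof.
  intros x1; apply peaked_eq_Xi; intros k _; right.
  generalize (s_lt_r (2 * k + 1)) (r_lt1 (2 * k + 1 + 1)); lra.
Qed.

(** Each clause prescribing the value of [Xi] concerns radii outside all the open annuli s_(2k) <
    |x| < s_(2k+1). The lower bound h_(2n) between them is where the size of the own peak
    matters. *)
Lemma peaked_admissible : admissible b c eps peaked.
Proof.
  assert (nn : forall x : R * R, 0 <= norm x) by (intros x; exact (norm_ge_0 x)).
  assert (out : forall x, 1 <= norm x -> peaked x = 1 + 2 * (norm x - 1)).
  { intros x x1; rewrite peaked_outer by lra; apply Xi_tilde_outer, x1. }
  assert (ins : forall x, norm x < 1 -> peaked x < 1).
  { intros x x1; eapply Rle_lt_trans; [apply peaked_le_Xi|].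
    apply Xi_tilde_lt1; split; [apply nn|exact x1]. }
  split.
  - apply lipschitz_continuous, peaked_lipschitz.
  - intros x; destruct (Rlt_dec (norm x) 1) as [l|l].
    + generalize (ins x l); lra.
    + rewrite out; lra.
  - intros x; destruct (Rlt_dec (norm x) 1) as [l|l].
    + generalize (ins x l); lra.
    + rewrite out; lra.
  - intros x; destruct (Rlt_dec (norm x) 1) as [l|l].
    + generalize (ins x l); lra.
    + rewrite out; lra.
  - exact peaked_le_Xi.
  - intros x H; apply peaked_eq_Xi; intros k _; left.
    generalize (r_le 0 (2 * k) ltac:(lia)) (r_lt_s (2 * k)); lra.
  - intros n x H; apply peaked_eq_Xi; intros k _.
    destruct (Nat.lt_ge_cases k n).
    + right; generalize (s_le_r (2 * k + 1) (2 * n) ltac:(lia)); lra.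
    + left; destruct (Nat.eq_dec n k) as [->|ne]; [lra|].
      generalize (s_le_r (2 * n) (2 * k) ltac:(lia)) (r_lt_s (2 * k)); lra.
  - intros n x H; apply peaked_eq_Xi; intros k _.
    destruct (Nat.lt_ge_cases n k).
    + left; generalize (r_le (2 * n + 2) (2 * k) ltac:(lia)) (r_lt_s (2 * k)); lra.
    + right; destruct (Nat.eq_dec n k) as [->|ne]; [lra|].
      generalize (s_le_r (2 * k + 1) (2 * n + 1) ltac:(lia)) (r_lt_s (2 * n + 1)); lra.
  - intros x H; apply peaked_outer; lra.
  - intros n x H; split; [|apply peaked_le_Xi].
    assert (XiH : h_ b c (2 * n) <= Xi b c eps x).
    { destruct (Rle_dec (norm x) (r_ (2 * n + 1))).
      - apply Xi_tilde_ge_h; generalize (r_lt_s (2 * n)); lra.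
      - unfold Xi; rewrite (Xi_tilde_flat (2 * n + 1)) by lra; left; apply h_lt. }
    destruct (peaked_cases x) as [->|[k [nk ->]]]; [exact XiH|].
    (* The peak of this annulus stays above h_(2n) by [far_bound_ge_h]; any other is above [Xi]
       here. *)
    destruct (Nat.eq_dec k n) as [->|ne].
    + assert (x1 : norm x <= 1).
      { generalize (s_lt_r (2 * n + 1)) (r_lt1 (2 * n + 1 + 1)); lra. }
      eapply Rle_trans; [|apply peak_ge_far_bound, norm_sigma].
      generalize (far_bound_ge_h (2 * n) (norm x) (large (2 * n + 1) ltac:(lia))
        ltac:(generalize (r_lt_s (2 * n)); lra)) (Rmax_l 0 (norm x - 1)); lra.
    + eapply Rle_trans; [exact XiH|apply peak_off_annulus; [exact nk|]].
      destruct (Nat.lt_ge_cases n k).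
      * left; generalize (s_le_r (2 * n + 1) (2 * k) ltac:(lia)) (r_lt_s (2 * k)); lra.
      * right; generalize (s_le_r (2 * k + 1) (2 * n) ltac:(lia)) (r_lt_s (2 * n)); lra.
Qed.

(** * Optimality of the points of [sigma] *)

Lemma folded_le (x : R * R) :
  1 - Rabs (1 - peaked x) <= Rmin (Xi b c eps x) 1 /\ 1 - Rabs (1 - peaked x) <= peaked x.
Proof.
  generalize (Rle_abs (1 - peaked x)) (Rabs_pos (1 - peaked x)) (peaked_le_Xi x); intros.
  split; [apply Rmin_glb|]; lra.
Qed.

Lemma minimizer_first : is_minimizer (fun x => Rabs (1 - peaked x) + 2 * norm x) (sigma 0%nat).
Proof.
  intros x; rewrite peaked_sigma, norm_sigma.
  generalize (h_bounds 0); intros; rewrite Rabs_pos_eq by lra.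
  generalize (proj1 (folded_le x)) (Xi_tilde_aligned_first (norm x) (norm_ge_0 x)).
  unfold Xi; lra.
Qed.

(** The hypothesis puts both points on one ray, so | |x| - r_n | <= |x - sigma_n| is an equality at
    sigma_(n+1) and the radial bound transfers. *)
Lemma minimizer_aligned (n : nat) :
  norm (minus (sigma (n + 1)) (sigma n)) = r_ (n + 1) - r_ n ->
  is_minimizer (fun x => b ^ (n + 1) * Rabs (1 - peaked x) + (b / c) ^ (n + 1) * norm x
                         + norm (minus x (sigma n))) (sigma (n + 1)).
Proof.
  intros al; apply minimizer_criterion; [apply peaked_sigma|apply norm_sigma|]; intros x.
  eapply Rle_trans; [exact (proj1 (folded_le x))|].
  eapply Rle_trans; [apply Xi_tilde_aligned; exact (norm_ge_0 x)|].
  apply Rplus_le_compat_l, Rmult_le_compat_l; [left; apply invb_pow_pos|].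
  assert (T := norm_minus_ge x (sigma n)); rewrite norm_sigma in T.
  rewrite al, !r_gap, gap_succ in *; lra.
Qed.

(** The peak at the new point controls N in all directions, so the triangle inequality through that
    point gives optimality whatever the angle between it and the previous point. *)
Lemma minimizer_peak (k : nat) : (nbar <= k)%nat ->
  is_minimizer (fun x => b ^ (2 * k + 1) * Rabs (1 - peaked x)
                         + (b / c) ^ (2 * k + 1) * norm x
                         + norm (minus x (sigma (2 * k)))) (sigma (2 * k + 1)).
Proof.
  intros nk; apply minimizer_criterion; [apply peaked_sigma|apply norm_sigma|]; intros x.
  set (q := sigma (2 * k + 1)); set (p := sigma (2 * k)).
  assert (tri : norm (minus q p) - norm (minus x p) <= norm (minus x q)).
  { assert (T := norm_minus_ge (minus x p) (minus q p)); rewrite minus_minus in T.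
    apply Rabs_le_between in T; lra. }
  assert (P := invb_pow_pos (2 * k + 1)).
  apply Rle_trans with (h_ b c (2 * k + 1) + (/ c) ^ (2 * k + 1) * (norm x - r_ (2 * k + 1))
                        - (/ b) ^ (2 * k + 1) * norm (minus x q)); [|nra].
  destruct (Rle_dec (norm x) 1) as [x1|x1].
  - eapply Rle_trans; [exact (proj2 (folded_le x))|].
    eapply Rle_trans; [apply (peaked_le_peak k), nk|].
    unfold pk, peak; fold q; rewrite Rmax_left; lra.
  (* Outside the disc the last term of the peak is positive, so the bound comes from the cap at 1
     and [far_bound] instead. *)
  - eapply Rle_trans; [exact (proj1 (folded_le x))|].
    eapply Rle_trans.
    + apply (far_bound_ge_Xi_tilde (2 * k)); [apply large; lia|exact (norm_ge_0 x)|].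
      right; generalize (s_lt_r (2 * k + 1)) (r_lt1 (2 * k + 1 + 1)); lra.
    + assert (D := norm_minus_le x q); unfold q in D at 2; rewrite norm_sigma in D.
      unfold far_bound; nra.
Qed.

End Peaks.

End Radial.

(** * Polar coordinates and the turning sequence *)

Lemma norm_polar (r t : R) : 0 <= r -> norm (r * cos t, r * sin t) = r.
Proof.
  intros r0; rewrite norm_euclidean; simpl fst; simpl snd.
  rewrite <- (sqrt_pow2 r) by exact r0; f_equal; rewrite sqrt_pow2 by exact r0.
  generalize (sin2_cos2 t); unfold Rsqr; intros; nra.
Qed.

Lemma minus_polar (r s t : R) :
  minus (r * cos t, r * sin t) (s * cos t, s * sin t) = ((r - s) * cos t, (r - s) * sin t).
Proof. cbv -[cos sin Rmult Rplus Ropp Rminus]; f_equal; ring. Qed.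

Theorem theoremA7 (b c eps : R) (hc : c >= 9) (hbc : b / c > 2) (heps : eps > 0) :
  exists (N : R * R -> R) (nbar : nat),
    lipschitz N /\ admissible b c eps N /\ (1 <= nbar)%nat /\
    exists (sigma : nat -> R * R),
      is_minimizer (fun x => Rabs (1 - N x) + 2 * norm x) (sigma 0%nat) /\
      (forall n : nat,
         is_minimizer
           (fun x => b ^ (n + 1) * Rabs (1 - N x) + (b / c) ^ (n + 1) * norm x
                     + norm (minus x (sigma n)))
           (sigma (n + 1)%nat)) /\
      exists theta : nat -> R,
        (forall n : nat, 0 <= theta n) /\
        (forall n : nat,
           sigma n = (r_ n * cos (theta n), r_ n * sin (theta n))) /\
        (forall n : nat, (n <= 2 * nbar)%nat -> theta n = 0) /\
        (forall m : nat, (1 <= m)%nat ->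
           theta (2 * nbar + 2 * m - 1)%nat = INR m * PI / 2 /\
           theta (2 * nbar + 2 * m)%nat = INR m * PI / 2).
Proof.
  destruct (step_large_eventually b c hc hbc) as [nbar [n1 large]].
  (* Truncated subtraction makes this 0 up to step 2 nbar. *)
  set (turns n := Nat.div (n + 1 - 2 * nbar) 2).
  set (theta n := INR (turns n) * PI / 2).
  set (sigma n := (r_ n * cos (theta n), r_ n * sin (theta n))).
  assert (norm_sigma : forall n, norm (sigma n) = r_ n).
  { intros n; apply norm_polar; generalize (r_pos n); lra. }
  assert (turnsE : forall n m, (2 * m <= n + 1 - 2 * nbar < 2 * m + 2)%nat -> turns n = m).
  { intros n m H; unfold turns; symmetry.
    apply (Nat.div_unique _ 2 m (n + 1 - 2 * nbar - 2 * m)); lia. }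
  exists (peaked b c eps nbar sigma), nbar; split; [|split; [|split; [exact n1|]]].
  - apply peaked_lipschitz; auto.
  - apply peaked_admissible; auto.
  - exists sigma; split; [|split].
    + apply minimizer_first; auto.
    + assert (aligned : forall n, turns (n + 1)%nat = turns n ->
        norm (minus (sigma (n + 1)%nat) (sigma n)) = r_ (n + 1) - r_ n).
      { intros n e; unfold sigma, theta; rewrite e, minus_polar; apply norm_polar.
        generalize (r_le n (n + 1) ltac:(lia)); lra. }
      (* A step out of an even index 2k turns exactly when k >= nbar; a step out of an odd index
         keeps the direction. *)
      intros n; destruct (Nat.Even_or_Odd n) as [[k ->]|[k ->]].
      * destruct (Nat.le_gt_cases nbar k) as [nk|nk].
        -- apply minimizer_peak; auto.
        -- apply minimizer_aligned; auto; apply aligned.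
           rewrite !(turnsE _ 0%nat); lia.
      (* Indices 2k + 1 and 2k + 2 share the count k + 1 - nbar, truncated at 0. *)
      * apply minimizer_aligned; auto; apply aligned.
        rewrite !(turnsE _ (k + 1 - nbar)%nat); lia.
    + exists theta; split; [|split; [reflexivity|split]].
      * intros n; unfold theta; generalize (pos_INR (turns n)) PI_RGT_0; intros; nra.
      * intros n H; unfold theta; rewrite (turnsE n 0%nat) by lia; simpl; lra.
      * intros m m1; unfold theta; split; rewrite (turnsE _ m) by lia; reflexivity.
Qed.
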